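(* Let $m>3$ be an integer and $q=2^m$. Then the trinomial $F(X)=X^{9}\left(X^{7(q-1)}+X^{3(q-1)}+1\right)$ is not a permutation polynomial of $\mathbb{F}_{q^2}$.
   Context: A polynomial $f\in\mathbb{F}_{q^2}[X]$ is a permutation polynomial of $\mathbb{F}_{q^2}$ if the map $x\mapsto f(x)$ is a bijection of $\mathbb{F}_{q^2}$. *)

(* Defs.v *)
From mathcomp Require Import all_boot all_order all_algebra all_field.

Set Implicit Arguments.
Unset Strict Implicit.
Unset Printing Implicit Defensive.

Import GRing.Theory.
Local Open Scope ring_scope.

Definition permutation_poly (K : finFieldType) (f : {poly K}) : Prop :=
  bijective (fun x : K => f.[x]).

(* Main.v *)
(* If m is even, F is invariant under multiplication by a primitive cube root of
   unity. Let m be odd. For z with z^q = z + 1 put t = z^4 + z and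
   y = t^2 + t + 1; then F(z) = y z + t, and F(b z) = b^9 F(z) for b in F_q. As
   9 is prime to q - 1, injectivity of F forces f(z) = z + phi, phi = t / y, to
   be injective, hence also the map tau : t |-> t + phi + phi^4 = f^4 + f on
   the trace-zero elements t of F_q. So t and tau(t) have the same fifth power
   sum over those t. Parametrising by y, which runs bijectively over the
   elements of trace 1, with t the half-trace of y + 1, reduces these sums to
   the sums of y^-k and t y^-k with k < 18. These count solutions of 2^j = k
   and of 2^j + 4^i = k, and the two fifth power sums come out differing by 1. *)

Require Import Defs.
From mathcomp Require Import all_boot all_order all_algebra all_field all_solvable.
From mathcomp Require Import ring zify.

Import GRing.Theory.
Local Open Scope ring_scope.

Section BinaryField.

Variables (K : finFieldType) (m : nat).
Hypothesis m_gt0 : (0 < m)%N.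
Local Notation q := (2 ^ m)%N.
Hypothesis cardK : #|K| = (q ^ 2)%N.

(** * Arithmetic in characteristic 2 *)

Lemma char2 : 2%N \in [pchar K].
Proof. by apply: (@card_finPcharP _ _ (m * 2)); rewrite // expnM. Qed.

Lemma addxx (x : K) : x + x = 0.
Proof. exact: addrr_pchar2 char2 _. Qed.

Lemma oppx (x : K) : - x = x.
Proof. exact: oppr_pchar2 char2 _. Qed.

Lemma addxK (x y : K) : x + y + y = x.
Proof. by rewrite -addrA addxx addr0. Qed.

Lemma addx_eq0 (x y : K) : x + y = 0 -> x = y.
Proof. by move/eqP; rewrite addr_eq0 oppx => /eqP. Qed.

(* [ring] ignores the characteristic, so the multiple of 2 by which the two sides
   differ is supplied by hand. *)
Lemma eq_mod2 (c x y : K) : x = y + 2 * c -> x = y.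
Proof. by move->; rewrite mulr_natl mulr2n addxx addr0. Qed.

Lemma frobD (x y : K) i : (x + y : K) ^+ (2 ^ i) = (x ^+ (2 ^ i) : K) + y ^+ (2 ^ i).
Proof. by apply: exprDn_pchar; rewrite (eq_pnat _ (pcharf_eq char2)) pnatX. Qed.

Lemma sqrD (x y : K) : (x + y : K) ^+ 2 = (x ^+ 2 : K) + y ^+ 2.
Proof. exact: (frobD x y 1). Qed.

Lemma frob_sum (I : Type) (r : seq I) (P : pred I) (f : I -> K) i :
  (\sum_(j <- r | P j) f j) ^+ (2 ^ i) = \sum_(j <- r | P j) f j ^+ (2 ^ i).
Proof.
apply: (big_morph (fun x : K => x ^+ (2 ^ i))) => [x y|]; first exact: frobD.
by rewrite expr0n expn_eq0.
Qed.

Lemma sqr_inj (x y : K) : x ^+ 2 = y ^+ 2 -> x = y.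
Proof.
move=> e; apply: addx_eq0; apply/eqP.
by rewrite -sqrf_eq0 sqrD e addxx.
Qed.

Lemma idem01 (x : K) : x ^+ 2 = x -> x = 0 \/ x = 1.
Proof.
move/eqP; rewrite -subr_eq0 expr2 -{3}[x]mulr1 -mulrBr mulf_eq0 subr_eq0.
by case/orP=> /eqP; [left | right].
Qed.

Lemma natr2 k : k%:R = (odd k)%:R :> K.
Proof. by rewrite -modn2 (GRing.natr_mod_pchar char2). Qed.

Lemma q_gt1 : (1 < q)%N.
Proof. by rewrite -{1}(expn0 2) ltn_exp2l. Qed.

(** * The subfield F_q, roots of unity, and power sums over F_q *)

Definition Fq : {pred K} := [pred x | x ^+ q == x].

Lemma FqP x : reflect (x ^+ q = x) (x \in Fq).
Proof. exact: eqP. Qed.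

Lemma FqD x y : x \in Fq -> y \in Fq -> x + y \in Fq.
Proof. by move=> /FqP hx /FqP hy; apply/FqP; rewrite frobD hx hy. Qed.

Lemma FqM x y : x \in Fq -> y \in Fq -> x * y \in Fq.
Proof. by move=> /FqP hx /FqP hy; apply/FqP; rewrite exprMn hx hy. Qed.

Lemma FqX x k : x \in Fq -> x ^+ k \in Fq.
Proof. by move=> /FqP hx; apply/FqP; rewrite exprAC hx. Qed.

Lemma FqV x : x \in Fq -> x^-1 \in Fq.
Proof. by move=> /FqP hx; apply/FqP; rewrite exprVn hx. Qed.

Lemma Fq0 : 0 \in Fq.
Proof. by apply/FqP; rewrite expr0n expn_eq0. Qed.

Lemma Fq1 : 1 \in Fq.
Proof. by apply/FqP; rewrite expr1n. Qed.

Lemma Fq_sum (I : Type) (r : seq I) (P : pred I) (f : I -> K) :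
  (forall i, P i -> f i \in Fq) -> \sum_(i <- r | P i) f i \in Fq.
Proof. by move=> hf; elim/big_ind: _ => //; [exact: Fq0 | exact: FqD]. Qed.

Lemma Fq_expV x : x \in Fq -> x != 0 -> x ^+ q.-1 = 1.
Proof.
move=> /FqP hx x0; apply: (mulfI x0).
by rewrite -exprS prednK ?hx ?mulr1 // expn_gt0.
Qed.

(** The order q^2 - 1 is kept factored: the power [q.+1] of [g] then generates the units of F_q, and
    divisibility by 3 is read off the two factors. *)
Lemma prim_root_K : exists g : K, (q.-1 * q.+1).-primitive_root g.
Proof.
have cardK1 : #|K|.-1 = (q.-1 * q.+1)%N.
  by rewrite cardK -subn1 -[X in (_ - X)%N](exp1n 2) subn_sqr subn1 addn1.
have K1 : (0 < #|K|.-1)%N by rewrite cardK1 muln_gt0 andbT -subn1 subn_gt0 q_gt1.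
pose rs := enum [pred x : K | x != 0].
have hs : size rs = #|K|.-1 by rewrite -cardE cardC1.
have : has (#|K|.-1).-primitive_root rs.
  apply: has_prim_root; rewrite ?enum_uniq ?hs //.
  apply/allP => x; rewrite mem_enum inE => x0; apply/unity_rootP.
  by apply: (mulfI x0); rewrite -exprS prednK ?expf_card ?mulr1 //; case: #|K| K1.
by case/hasP=> g _; rewrite cardK1; exists g.
Qed.

Lemma prim_root_Fq : exists2 g : K, g \in Fq & (q.-1).-primitive_root g.
Proof.
have [g hg] := prim_root_K; exists (g ^+ q.+1).
  apply/FqP; rewrite -exprM; apply/eqP; rewrite (eq_prim_root_expr hg).
  have -> : (q.+1 * q = q.+1 + q.-1 * q.+1)%N.
    by have := q_gt1; case: q => // k _ /=; nia.
  by rewrite modnDr.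
by have := dvdn_prim_root hg (dvdn_mulr _ (dvdnn _)); rewrite mulKn // -subn1 subn_gt0 q_gt1.
Qed.

Lemma cube_root1 : exists2 w : K, w != 1 & w ^+ 3 = 1.
Proof.
have [g hg] := prim_root_K.
have d3 : (3 %| q.-1 * q.+1)%N.
  have : (q %% 3 != 0)%N by rewrite -/(3 %| q)%N Euclid_dvdX.
  by have := q_gt1; move: q => Q; nia.
exists (g ^+ ((q.-1 * q.+1) %/ 3)); last exact: prim_expr_order (dvdn_prim_root hg d3).
by have := prim_order_dvd (dvdn_prim_root hg d3) 1; rewrite expr1 => <-.
Qed.

(** The translation by 1 permutes F_q, so adding this sum to the sum of all elements of F_q changes
    nothing. No count of F_q is required. *)
Lemma sum_Fq1 : \sum_(x in Fq) (1 : K) = 0.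
Proof.
have := reindex_inj (op := +%R) (x := 0) (P := [in Fq]) (F := id) (addIr (1 : K)).
rewrite [in RHS](eq_bigl [in Fq]) => [|x]; last first.
  by rewrite !inE frobD expr1n (inj_eq (addIr _)).
by rewrite big_split /= -{1}[LHS]addr0 => /addrI <-.
Qed.

(** If q - 1 divides e, every nonzero x contributes 1, and by [sum_Fq1] these ones add up to -1 = 1.
    Otherwise scaling by a generator g multiplies the sum by g^e, which is not 1, so the sum
    vanishes. *)
Lemma sum_Fq_exp e : (0 < e)%N -> \sum_(x in Fq) x ^+ e = (q.-1 %| e)%:R.
Proof.
move=> e0; have [g gF hg] := prim_root_Fq.
have g0 : g != 0.
  by apply/eqP=> g0; have /eqP := prim_expr_order hg;
     rewrite g0 expr0n eqn0Ngt (prim_order_gt0 hg) eq_sym oner_eq0.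
have [dv|ndv] := boolP (q.-1 %| e)%N.
  have F0 : 0 \in Fq by exact: Fq0.
  have := sum_Fq1; rewrite (bigD1 _ F0) /= => /eqP; rewrite addr_eq0 oppx => /eqP ->.
  rewrite (bigD1 _ F0) /= expr0n eqn0Ngt e0 add0r; apply: eq_bigr => x /andP[xF x0].
  by case/dvdnP: dv => k ->; rewrite mulnC exprM Fq_expV // expr1n.
have := reindex_inj (op := +%R) (x := 0) (P := [in Fq]) (F := fun x => x ^+ e) (mulfI g0).
rewrite [in RHS](eq_bigl [in Fq]) => [|x]; last first.
  by rewrite !inE exprMn (FqP _ gF) (inj_eq (mulfI g0)).
under [in RHS]eq_bigr do rewrite exprMn.
rewrite -mulr_sumr -{1}[LHS]mul1r => /eqP; rewrite -subr_eq0 -mulrBl mulf_eq0.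
by rewrite subr_eq0 eq_sym -(prim_order_dvd hg) (negPf ndv) => /eqP.
Qed.

(** * The absolute trace of F_q and power sums over the elements of trace 1 *)

Definition Tr (x : K) : K := \sum_(0 <= j < m) x ^+ (2 ^ j).

Lemma TrD x y : Tr (x + y) = Tr x + Tr y.
Proof. by rewrite -big_split; apply: eq_bigr => i _; rewrite frobD. Qed.

Lemma Tr1 : Tr 1 = m%:R.
Proof.
rewrite /Tr; under eq_bigr do rewrite expr1n.
by rewrite big_const_nat subn0 -Monoid.iteropE.
Qed.

Lemma Tr_sqr x : x \in Fq -> Tr (x ^+ 2) = Tr x.
Proof.
move=> /FqP hx; rewrite /Tr; under eq_bigr do rewrite -exprM -expnS.
case: m m_gt0 hx => // k _ hx.
by rewrite big_nat_recr // big_nat_recl //= hx addrC expn0 expr1.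
Qed.

Lemma Tr_frob x i : x \in Fq -> Tr (x ^+ (2 ^ i)) = Tr x.
Proof.
move=> hx; elim: i => [|i IH]; first by rewrite expr1.
by rewrite expnSr exprM Tr_sqr ?IH ?FqX.
Qed.

Lemma Tr01 x : x \in Fq -> Tr x = 0 \/ Tr x = 1.
Proof.
move=> hx; apply: idem01; rewrite -[in RHS](Tr_sqr _ hx) /Tr (frob_sum _ _ _ _ 1).
by apply: eq_bigr => i _; rewrite exprAC.
Qed.

Definition T1 : {pred K} := [pred y | (y \in Fq) && (Tr y == 1)].

Lemma T1P y : reflect (y \in Fq /\ Tr y = 1) (y \in T1).
Proof. by apply: (iffP andP) => -[? /eqP ?]; split=> //; apply/eqP. Qed.

(** On F_q the trace takes only the values 0 and 1, so it is its own indicator of [T1]. Being a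
    polynomial, it turns sums over [T1] into power sums over F_q. *)
Lemma sum_T1 (f : K -> K) : \sum_(y in T1) f y = \sum_(y in Fq) Tr y * f y.
Proof.
rewrite [RHS](bigID [pred y | Tr y == 1]) /= [X in _ + X]big1 ?addr0.
  by apply: eq_bigr => y /andP[_ /eqP ->]; rewrite mul1r.
move=> y /andP[/Tr01[] -> ]; first by rewrite mul0r.
by rewrite eqxx.
Qed.

Lemma sum_T1_exp e :
  \sum_(y in T1) y ^+ e = (\sum_(0 <= j < m) (q.-1 %| 2 ^ j + e))%N%:R.
Proof.
rewrite sum_T1 natr_sum; under [LHS]eq_bigr do rewrite /Tr mulr_suml.
rewrite exchange_big; apply: eq_bigr => j _ /=.
under eq_bigr do rewrite -exprD.
by rewrite sum_Fq_exp // addn_gt0 expn_gt0.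
Qed.


Lemma T1_neq0 y : y \in T1 -> y != 0.
Proof.
case/T1P=> _ hT; apply/eqP=> y0; move: hT; rewrite y0 /Tr big1_seq.
  by move/eqP; rewrite eq_sym oner_eq0.
by move=> j _; rewrite expr0n expn_eq0.
Qed.

(** Negative powers become nonnegative ones, to which [sum_T1_exp] and [sum_HX] apply. *)
Lemma T1_expV k y : (k < q)%N -> y \in T1 -> y^-1 ^+ k = y ^+ (q.-1 - k).
Proof.
move=> hk hy; have y0 := T1_neq0 _ hy; have [yF _] := T1P _ hy.
have e : (q.-1 - k + k = q.-1)%N by rewrite subnK // -ltnS prednK ?expn_gt0.
by rewrite exprVn; apply/(mulIf (expf_neq0 k y0)); rewrite -exprD e mulVf ?expf_neq0 // Fq_expV.
Qed.

(** * The function defined by F, and the case of even m *)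

Definition evalF (X : K) : K := X ^+ 9 * (X ^+ (7 * (q - 1)) + X ^+ (3 * (q - 1)) + 1).

Lemma evalF_not_inj_even : (3 %| q - 1)%N -> ~ injective evalF.
Proof.
case/dvdnP=> k hk F_inj; have [w w1 w3] := cube_root1.
case/eqP: w1; apply: F_inj; rewrite /evalF !expr1n hk mulnA !(mulnC _ 3) !(exprM _ 3) w3 !expr1n.
by rewrite (exprM _ 3 3) w3 expr1n.
Qed.

(** * Odd m: the half-trace and the parametrisation by elements of trace 1 *)

Section OddDegree.

Variable n : nat.
Hypotheses (m_gt4 : (4 < m)%N) (def_n : n.*2 = m.+1).

Lemma q_ge32 : (32 <= q)%N.
Proof. by rewrite (@leq_exp2l 2 5). Qed.

Lemma n_gt2 : (2 < n)%N.
Proof. by rewrite -leq_double def_n. Qed.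

Definition half_trace (c : K) : K := \sum_(0 <= i < n) c ^+ (4 ^ i).

Lemma HD x y : half_trace (x + y) = half_trace x + half_trace y.
Proof. by rewrite -big_split; apply: eq_bigr => i _; rewrite -(expnM 2 2) frobD. Qed.

Lemma H_Fq x : x \in Fq -> half_trace x \in Fq.
Proof. by move=> hx; apply: Fq_sum => i _; apply: FqX. Qed.

Lemma H1 : half_trace 1 = n%:R.
Proof.
rewrite /half_trace; under eq_bigr do rewrite expr1n.
by rewrite big_const_nat subn0 -Monoid.iteropE.
Qed.

Lemma H_sqr x : half_trace (x ^+ 2) = half_trace x ^+ 2.
Proof. by rewrite (frob_sum _ _ _ _ 1); apply: eq_bigr => i _; rewrite exprAC. Qed.

Lemma Tr_H x : x \in Fq -> Tr (half_trace x) = n%:R * Tr x.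
Proof.
move=> hx; rewrite /half_trace (big_morph Tr TrD (id1 := 0)); last first.
  by rewrite /Tr big1_seq // => j _; rewrite expr0n expn_eq0.
rewrite (eq_bigr (fun=> Tr x)) => [|i _]; last by rewrite -(expnM 2 2) Tr_frob.
by rewrite big_const_nat subn0 iter_addr_0 mulr_natl.
Qed.

(** The exponents 4^i of the half-trace and 2 * 4^i of its square interleave to all 2^j with j < 2n
    = m + 1; the last term is c^q = c. *)
Lemma H_double c : c \in Fq -> half_trace c ^+ 2 + half_trace c = Tr c + c.
Proof.
move=> /FqP hc; have -> : Tr c + c = \sum_(0 <= j < n.*2) c ^+ (2 ^ j).
  by rewrite def_n big_nat_recr //= hc.
rewrite /half_trace (frob_sum _ _ _ _ 1); elim: n => [|k IH]; first by rewrite !big_geq ?addr0.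
have e : (4 ^ k = 2 ^ k.*2)%N by rewrite -(expnM 2 2) mul2n.
rewrite doubleS !big_nat_recr //= -IH e -exprM -expnD addn1; ring.
Qed.

Lemma H_K x : x \in Fq -> Tr x = 0 -> half_trace (x ^+ 2 + x) = x.
Proof. by move=> xF hT; rewrite HD H_sqr H_double // hT add0r. Qed.

(** For y in [T1] the equation t^2 + t + 1 = y has two roots in F_q, differing by 1. As Tr 1 = 1 for
    odd m, exactly one has trace 0, and the half-trace selects it. *)
Definition t (y : K) : K := half_trace (y + 1).

Lemma t_Fq y : y \in T1 -> t y \in Fq.
Proof. by case/T1P=> yF _; apply: H_Fq; rewrite FqD // Fq1. Qed.

Lemma odd_m : odd m.
Proof. by rewrite -[m]/(m.+1.-1) -def_n; case: n n_gt2 => // k _; rewrite doubleS /= odd_double. Qed.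

Lemma TrS1 : Tr 1 = 1.
Proof. by rewrite Tr1 natr2 odd_m. Qed.

Lemma Tr_shift y : y \in T1 -> Tr (y + 1) = 0.
Proof. by case/T1P=> _ hT; rewrite TrD hT TrS1 addxx. Qed.

Lemma Tr_t y : y \in T1 -> Tr (t y) = 0.
Proof.
move=> hy; rewrite Tr_H ?Tr_shift ?mulr0 //.
by case/T1P: hy => yF _; rewrite FqD // Fq1.
Qed.

Lemma t_sqr y : y \in T1 -> t y ^+ 2 = t y + y + 1.
Proof.
move=> hy; have [yF _] := T1P _ hy.
have := H_double _ (FqD _ _ yF Fq1); rewrite -/(t y) Tr_shift // add0r => h.
by rewrite -[LHS](addxK _ (t y)) h addrC addrA.
Qed.

(** * Power sums as counts of sums of powers of 2 *)

Lemma dvdn_qV s k : (0 < s < q.-1 + k)%N -> (0 < k < 18)%N ->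
  (q.-1 %| s + (q.-1 - k))%N = (s == k).
Proof.
have := q_ge32; move: q => Q hQ /andP[s1 sq] /andP[k1 k18].
(* Since q >= 32 and k < 18, the dividend lies strictly between 0 and 2(q - 1), so the quotient is
   1. *)
apply/idP/eqP => [/dvdnP[c hc]|->]; last by rewrite subnKC //; lia.
have : (c = 1)%N by nia.
move=> c1; rewrite c1 in hc; lia.
Qed.

(** The values q - 1 and q - 2 are ruled out because they are the ones for which q - 1 would divide
    2^j + 4^i + e with e = 0 or 1, as needed in [sum_HX0]. *)
Lemma pow2_sum_bounds i j : (i < n)%N -> (j < m)%N ->
  [/\ (0 < 2 ^ j + 4 ^ i <= q)%N, (2 ^ j + 4 ^ i != q.-1)%N & (2 ^ j + 4 ^ i != q.-2)%N].
Proof.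
move=> hi hj; rewrite -(expnM 2 2).
have {hi} : (2 * i < m)%N by lia.
move: (2 * i)%N => k hk.
(* With 2^p = q/4, each of the two powers is q/2 or at most q/4. Their sum is therefore q or at most
   3q/4, which is below q - 2. *)
have [p hp] : exists p, m = p.+2 by case: m m_gt4 => [|[|p]] // _; exists p.
have X8 : (8 <= 2 ^ p)%N by rewrite (@leq_exp2l 2 3) //; move: m_gt4; rewrite hp; lia.
have q4 : q = (4 * 2 ^ p)%N by rewrite hp !expnS mulnA.
have D a : (a < m)%N -> (2 ^ a = 2 * 2 ^ p \/ 2 ^ a <= 2 ^ p)%N.
  rewrite hp ltnS leq_eqVlt => /orP[/eqP->|]; first by left; rewrite expnS.
  by rewrite ltnS => h; right; rewrite leq_exp2l.
have j0 : (0 < 2 ^ j)%N by rewrite expn_gt0.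
have k0 : (0 < 2 ^ k)%N by rewrite expn_gt0.
move: (D _ hj) (D _ hk) j0 k0 X8; rewrite q4.
move: (2 ^ j)%N (2 ^ k)%N (2 ^ p)%N => a b c ha hb a0 b0 c8; split; lia.
Qed.

Lemma sum_HX e :
  \sum_(y in T1) half_trace y * y ^+ e =
    (\sum_(0 <= i < n) \sum_(0 <= j < m) (q.-1 %| 2 ^ j + 4 ^ i + e))%N%:R.
Proof.
under [LHS]eq_bigr do rewrite /half_trace mulr_suml; rewrite exchange_big natr_sum.
apply: eq_bigr => i _ /=; under eq_bigr do rewrite -exprD.
by rewrite sum_T1_exp; congr (_%:R); apply: eq_bigr => j _; rewrite addnA.
Qed.

Lemma sum_HX0 e : (e < 2)%N -> \sum_(y in T1) half_trace y * y ^+ e = 0.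
Proof.
move=> he; rewrite sum_HX big_nat big1 // => i hi; rewrite big_nat big1 // => j hj.
have [/andP[s1 sq]] := pow2_sum_bounds _ _ hi hj.
have := q_ge32; move: q (_ + 4 ^ i)%N s1 sq => Q s s1 sq hQ n1 n2.
apply/eqP; rewrite eqb0; apply/negP => /dvdnP[c hc].
have c1 : c = 1%N by nia.
by rewrite c1 in hc; lia.
Qed.

(** As 4^3 and 2^5 exceed k, only i < 3 and j < 5 can contribute, which makes the count independent
    of m. The value k = 1 is left out because 2^j + 4^i = q does occur, and q - 1 divides q + (q -
    2). *)
Lemma sum_HXV k : (1 < k < 18)%N -> \sum_(y in T1) half_trace y * y^-1 ^+ k =
  (\sum_(0 <= i < 3) \sum_(0 <= j < 5) (2 ^ j + 4 ^ i == k))%N%:R.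
Proof.
move=> hk; have [_ k18] := andP hk.
rewrite (eq_bigr (fun y => half_trace y * y ^+ (q.-1 - k))) => [|y hy]; last first.
  by rewrite T1_expV // (leq_trans k18) // (leq_trans _ q_ge32).
rewrite sum_HX; congr (_%:R).
have dv s : (0 < s <= q)%N -> (q.-1 %| s + (q.-1 - k))%N = (s == k).
  by move=> hs; apply: dvdn_qV; have := q_ge32; lia.
rewrite (big_cat_nat (n := 3)) ?n_gt2 //= [X in (_ + X)%N]big_nat [X in (_ + X)%N]big1 => [|i /andP[i3 hi]].
  rewrite addn0 [LHS]big_nat [RHS]big_nat; apply: eq_bigr => i /= hi.
  have {}hi : (i < n)%N by rewrite (leq_trans hi) ?n_gt2.
  rewrite (big_cat_nat (n := 5)) //= [X in (_ + X)%N]big_nat [X in (_ + X)%N]big1 => [|j /andP[j5 hj]].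
    rewrite addn0 [LHS]big_nat [RHS]big_nat; apply: eq_bigr => j /= hj.
    have {}hj : (j < m)%N by rewrite (leq_trans hj).
    by have [h _ _] := pow2_sum_bounds _ _ hi hj; rewrite dv.
  have [h _ _] := pow2_sum_bounds _ _ hi hj; rewrite dv //.
  have : (32 <= 2 ^ j)%N by rewrite (@leq_exp2l 2 5).
  by lia.
rewrite big_nat big1 // => j hj; have [h _ _] := pow2_sum_bounds _ _ hi hj; rewrite dv //.
have : (64 <= 4 ^ i)%N by rewrite (@leq_exp2l 4 3).
by lia.
Qed.


Lemma sum_expV k : (0 < k < 18)%N ->
  \sum_(y in T1) y^-1 ^+ k = (\sum_(0 <= j < 5) (2 ^ j == k))%N%:R.
Proof.
move=> hk; have [_ k18] := andP hk.
rewrite (eq_bigr (fun y => y ^+ (q.-1 - k))) => [|y hy]; last first.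
  by rewrite T1_expV // (leq_trans k18) // (leq_trans _ q_ge32).
rewrite sum_T1_exp; congr (_%:R).
have dv j : (j < m)%N -> (q.-1 %| 2 ^ j + (q.-1 - k))%N = (2 ^ j == k)%N.
  move=> hj; apply: dvdn_qV => //.
  have : (2 ^ j < q)%N by rewrite ltn_exp2l.
  have : (0 < 2 ^ j)%N by rewrite expn_gt0.
  by lia.
rewrite (big_cat_nat (n := 5)) //= [X in (_ + X)%N]big_nat [X in (_ + X)%N]big1 => [|j /andP[j5 hj]].
  rewrite addn0 [LHS]big_nat [RHS]big_nat; apply: eq_bigr => j /= hj.
  by rewrite dv // (leq_trans hj).
rewrite dv //; have : (32 <= 2 ^ j)%N by rewrite (@leq_exp2l 2 5).
by lia.
Qed.

Lemma sum_T1_exp0 e : (e < 2)%N -> \sum_(y in T1) y ^+ e = 0.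
Proof.
move=> he; rewrite sum_T1_exp big_nat big1 // => j hj.
have : (2 * 2 ^ j <= q)%N by rewrite -expnS leq_exp2l.
have : (0 < 2 ^ j)%N by rewrite expn_gt0.
move: q (2 ^ j)%N q_ge32 => Q s hQ s0 sQ.
by apply/eqP; rewrite eqb0 gtnNdvd //; lia.
Qed.

(** The second term comes from [half_trace 1], which equals n in K; the sums thus depend on the
    parity of n, that is, on m modulo 4. *)
Lemma sum_tXV k : (1 < k < 18)%N -> \sum_(y in T1) t y * y^-1 ^+ k =
  (\sum_(0 <= i < 3) \sum_(0 <= j < 5) (2 ^ j + 4 ^ i == k))%N%:R
  + n%:R * (\sum_(0 <= j < 5) (2 ^ j == k))%N%:R.
Proof.
move=> hk; rewrite -sum_HXV // -sum_expV; last by case/andP: hk => /ltnW -> ->.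
rewrite mulr_sumr -big_split; apply: eq_bigr => y _ /=.
by rewrite /t HD H1 mulrDl.
Qed.

Lemma sum_tX0 e : (e < 2)%N -> \sum_(y in T1) t y * y ^+ e = 0.
Proof.
move=> he; under eq_bigr do rewrite /t HD H1 mulrDl.
by rewrite big_split /= -mulr_sumr sum_HX0 // sum_T1_exp0 // mulr0 addr0.
Qed.

(** * The fifth power sum of [tau] *)

Lemma t_exp4 y : y \in T1 -> t y ^+ 4 = t y + y + y ^+ 2.
Proof.
move=> hy; rewrite (exprM _ 2 2) t_sqr // !sqrD t_sqr // expr1n.
by apply: (eq_mod2 1); ring.
Qed.

Lemma t_exp16 y : y \in T1 -> t y ^+ 16 = t y + y + y ^+ 2 + y ^+ 4 + y ^+ 8.
Proof.
move=> hy; rewrite (exprM _ 4 4) t_exp4 // (frobD _ _ 2) (frobD _ _ 2) t_exp4 //.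
by rewrite -[(2 ^ 2)%N]/4%N; ring.
Qed.

Definition phi (y : K) : K := t y / y.

Definition tau (y : K) : K := t y + phi y + phi y ^+ 4.

(** The relation t^2 = t + y + 1 makes every power of t linear in t over the polynomials in y, so
    the sums below reduce to [V], [P] and the vanishing sums with exponent 0 or 1. *)
Definition V (k : nat) : K := \sum_(y in T1) t y * y^-1 ^+ k.
Definition P (k : nat) : K := \sum_(y in T1) y^-1 ^+ k.

Lemma sum_phi_t : \sum_(y in T1) phi y * t y = V 1 + P 1.
Proof.
(* The inserted zero is the sum of the constant term in t^2 / y = t / y + 1 + 1 / y. *)
rewrite -[RHS]addr0 -[X in _ = _ + X](sum_T1_exp0 0) // /V /P -!big_split; apply: eq_bigr => y hy /=.
by have y0 := T1_neq0 _ hy; rewrite /phi mulrAC -expr2 t_sqr //; field.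
Qed.

Lemma sum_t_phi4 : \sum_(y in T1) t y * phi y ^+ 4 = V 4 + V 3 + V 2 + P 3 + P 4.
Proof.
rewrite /V /P -!big_split; apply: eq_bigr => y hy /=.
have y0 := T1_neq0 _ hy; rewrite /phi expr_div_n t_exp4 //.
transitivity ((t y ^+ 2 + t y * y + t y * y ^+ 2) / y ^+ 4); first by field.
by rewrite t_sqr //; field.
Qed.

Lemma sum_t4_phi : \sum_(y in T1) t y ^+ 4 * phi y = V 1 + P 1.
Proof.
have h0 := sum_tX0 0 isT; have h1 := sum_tX0 1 isT.
(* Here t^5 / y = t / y + 1 / y + 1 + t + t y, and the last three terms have zero sum over [T1]. *)
rewrite -[RHS]addr0 -[X in _ = _ + X](sum_T1_exp0 0) // -[RHS]addr0 -[X in _ = _ + X]h0 -[RHS]addr0 -[X in _ = _ + X]h1.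
rewrite /V /P -!big_split; apply: eq_bigr => y hy /=.
have y0 := T1_neq0 _ hy; rewrite /phi t_exp4 //.
transitivity ((t y ^+ 2 + t y * y + t y * y ^+ 2) / y); first by field.
by rewrite t_sqr //; field.
Qed.

Lemma sum_phi5 : \sum_(y in T1) phi y ^+ 5 = V 5 + V 4 + V 3 + P 4 + P 5.
Proof.
rewrite /V /P -!big_split; apply: eq_bigr => y hy /=.
have y0 := T1_neq0 _ hy; rewrite /phi expr_div_n exprS t_exp4 //.
transitivity ((t y ^+ 2 + t y * y + t y * y ^+ 2) / y ^+ 5); first by field.
by rewrite t_sqr //; field.
Qed.

Lemma sum_t_phi16 : \sum_(y in T1) t y * phi y ^+ 16 =
  V 16 + V 15 + V 14 + V 12 + V 8 + P 15 + P 16.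
Proof.
rewrite /V /P -!big_split; apply: eq_bigr => y hy /=.
have y0 := T1_neq0 _ hy; rewrite /phi expr_div_n t_exp16 //.
transitivity ((t y ^+ 2 + t y * (y + y ^+ 2 + y ^+ 4 + y ^+ 8)) / y ^+ 16); first by field.
by rewrite t_sqr //; field.
Qed.

Lemma sum_phi17 : \sum_(y in T1) phi y ^+ 17 =
  V 17 + V 16 + V 15 + V 13 + V 9 + P 16 + P 17.
Proof.
rewrite /V /P -!big_split; apply: eq_bigr => y hy /=.
have y0 := T1_neq0 _ hy; rewrite /phi expr_div_n exprS t_exp16 //.
transitivity ((t y ^+ 2 + t y * (y + y ^+ 2 + y ^+ 4 + y ^+ 8)) / y ^+ 17); first by field.
by rewrite t_sqr //; field.
Qed.

(** This gives access to [V 1], which [sum_tXV] does not cover: squaring is additive and injective,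
    and moves the exponent 1 to 2. *)
Lemma V1_sqr : V 1 ^+ 2 = V 2 + P 1 + P 2.
Proof.
rewrite /V /P (frob_sum _ _ _ _ 1) -!big_split; apply: eq_bigr => y hy /=.
by have y0 := T1_neq0 _ hy; rewrite exprMn t_sqr //; field.
Qed.

Lemma V_val k : (1 < k < 18)%N -> V k =
  (odd (\sum_(0 <= i < 3) \sum_(0 <= j < 5) (2 ^ j + 4 ^ i == k)))%N%:R
  + (odd n && odd (\sum_(0 <= j < 5) (2 ^ j == k)))%N%:R.
Proof. by move=> hk; rewrite -oddM -!natr2 natrM -sum_tXV. Qed.

Lemma P_val k : (0 < k < 18)%N -> P k = (odd (\sum_(0 <= j < 5) (2 ^ j == k)))%N%:R.
Proof. by move=> hk; rewrite -natr2 -sum_expV. Qed.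

Lemma V1_val : V 1 = (~~ odd n)%:R.
Proof.
apply: sqr_inj; rewrite V1_sqr V_val // !P_val // unlock /= andbT.
by case: (odd n); rewrite -!natrD -natrX natr2 [in RHS]natr2.
Qed.

Lemma sum_tau5 : \sum_(y in T1) tau y ^+ 5 = \sum_(y in T1) t y ^+ 5 + 1.
Proof.
(* Expanding tau * tau^4 with tau^4 = t^4 + phi^4 + phi^16 gives nine products. Those that are 4th
   or 8th powers, namely (phi t)^4, phi^8 and (phi^5)^4, are summed by taking the Frobenius power of
   a simpler sum. *)
have -> : \sum_(y in T1) tau y ^+ 5 = \sum_(y in T1) t y ^+ 5
  + \sum_(y in T1) t y * phi y ^+ 4 + \sum_(y in T1) t y * phi y ^+ 16
  + \sum_(y in T1) t y ^+ 4 * phi y + \sum_(y in T1) phi y ^+ 5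
  + \sum_(y in T1) phi y ^+ 17 + (\sum_(y in T1) phi y * t y) ^+ 4
  + (\sum_(y in T1) t y * y^-1 ^+ 1) ^+ 8 + (\sum_(y in T1) phi y ^+ 5) ^+ 4.
  rewrite (frob_sum _ _ _ _ 2) (frob_sum _ _ _ _ 3) (frob_sum _ _ _ _ 2) -!big_split.
  apply: eq_bigr => y _ /=; rewrite exprS [tau y ^+ 4](frobD _ _ 2) (frobD _ _ 2).
  rewrite expr1 -/(phi y) /tau -[(2 ^ 2)%N]/4%N -[(2 ^ 3)%N]/8%N; ring.
rewrite sum_phi_t sum_t_phi4 sum_t4_phi sum_phi5 sum_t_phi16 sum_phi17 -/(V 1).
(* The sum of t^5 cancels unevaluated. The other eight sums are explicit bits, and their total is 1
   for either parity of n. *)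
rewrite -!addrA; congr (_ + _); rewrite V1_val !V_val // !P_val // unlock.
by case: (odd n); rewrite -!(natrD, natrX) natr2.
Qed.


(** * From injectivity of F to a permutation of the elements of trace 1 *)

Lemma q_mod3 : (q %% 3 = 2)%N.
Proof.
have : (2 * q = 1 %[mod 3])%N.
  by rewrite -expnS -def_n -mul2n expnM -modnXm exp1n.
by move: q => Q; lia.
Qed.

(** For a primitive cube root of unity, w^q = w^2 because q is 2 modulo 3. Adding elements of F_q to
    w yields further solutions of z^q = z + 1. *)
Lemma omega_ex : exists2 w : K, w ^+ 2 = w + 1 & w ^+ q = w + 1.
Proof.
have [w w1 w3] := cube_root1.
have w2 : w ^+ 2 = w + 1.
  have : (w - 1) * (w ^+ 2 + w + 1) = 0 by transitivity (w ^+ 3 - 1); [ring | rewrite w3 subrr].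
  move/eqP; rewrite mulf_eq0 subr_eq0 (negPf w1) -addrA /= => /eqP; exact: addx_eq0.
exists w => //; rewrite (divn_eq q 3) q_mod3 mulnC exprD exprM w3 expr1n mul1r.
exact: w2.
Qed.

Lemma ninth_root (c : K) : c \in Fq -> c != 0 -> exists2 b : K, b \in Fq & b ^+ 9 = c.
Proof.
move=> cF c0; have q1 : (0 < q.-1)%N by rewrite -subn1 subn_gt0 q_gt1.
have cop : coprime q.-1 9.
  rewrite coprime_sym (@coprimeXl 2 3) // prime_coprime //.
  by have := q_mod3; have := q_gt1; move: q => Q; lia.
(* Bezout gives a with q - 1 dividing 1 + 9a, so c * c^(9a) = 1 and the root is the inverse of
   c^a. *)
have [a _] := Bezoutl 9 q1; rewrite (eqP cop) => /dvdnP[k hk].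
have ca : c * (c ^+ a) ^+ 9 = 1.
  by rewrite -exprM -exprS -[_.+1]/(1 + a * 9)%N hk mulnC exprM Fq_expV // expr1n.
exists (c ^+ a)^-1; first by rewrite FqV // FqX.
by rewrite exprVn; apply: (mulIf (expf_neq0 9 (expf_neq0 a c0))); rewrite ca mulVf // !expf_neq0.
Qed.

Lemma conj_neq0 (z : K) : z ^+ q = z + 1 -> z != 0.
Proof.
move=> hz; apply/eqP=> z0; move/eqP: hz.
by rewrite z0 expr0n expn_eq0 add0r eq_sym oner_eq0.
Qed.

Lemma evalF_conj (z : K) : z ^+ q = z + 1 ->
  evalF z = z * ((z ^+ 4 + z) ^+ 2 + (z ^+ 4 + z) + 1) + (z ^+ 4 + z).
Proof.
move=> hz; have z0 := conj_neq0 z hz; rewrite sqrD.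
have hz1 : z ^+ (q - 1) = (z + 1) / z.
  by rewrite -hz -{2}(subnK (ltnW q_gt1)) addn1 exprSr mulfK.
rewrite /evalF !(mulnC _ (q - 1)%N) !(exprM _ (q - 1)%N) hz1.
transitivity (z ^+ 2 * (z + 1) ^+ 7 + z ^+ 6 * (z + 1) ^+ 3 + z ^+ 9); first by field.
(* The witness is half the difference of the two sides expanded with integer coefficients. *)
apply: (eq_mod2 (z ^+ 9 + 5 * z ^+ 8 + 12 * z ^+ 7 + 18 * z ^+ 6 + 17 * z ^+ 5
  + 10 * z ^+ 4 + 3 * z ^+ 3 - z)); ring.
Qed.

Lemma evalF_homog (b z : K) : b \in Fq -> b != 0 -> evalF (b * z) = b ^+ 9 * evalF z.
Proof.
move=> bF b0; have b1 : b ^+ (q - 1) = 1 by rewrite subn1 Fq_expV.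
rewrite /evalF !exprMn !(mulnC _ (q - 1)%N) !(exprM b) b1 !expr1n !mul1r; ring.
Qed.

(** Since z^4 + z is the map x -> x^2 + x applied twice, two half-traces solve z^4 + z = t inside
    F_q, all traces involved being 0. Adding w, which satisfies w^4 = w, keeps the equation and
    brings in z^q = z + 1. *)
Lemma evalF_fiber y : y \in T1 -> exists z : K,
  [/\ z ^+ q = z + 1, z ^+ 4 + z = t y & y = t y ^+ 2 + t y + 1].
Proof.
move=> hy; have [w w2 wq] := omega_ex.
have tF := t_Fq _ hy; have hF := H_Fq _ tF.
have e1 : half_trace (t y) ^+ 2 + half_trace (t y) = t y by rewrite H_double // Tr_t // add0r.
have e2 : half_trace (half_trace (t y)) ^+ 2 + half_trace (half_trace (t y)) = half_trace (t y).
  by rewrite H_double // Tr_H // Tr_t // mulr0 add0r.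
exists (w + half_trace (half_trace (t y))); split.
- by rewrite frobD wq (FqP _ (H_Fq _ hF)) addrAC.
- rewrite (frobD _ _ 2) -[RHS]e1 -[in RHS]e2 sqrD -!exprM.
  have -> : w ^+ (2 ^ 2) = w by rewrite (exprM _ 2 2) w2 sqrD expr1n w2 addxK.
  apply: (eq_mod2 (w - half_trace (half_trace (t y)) ^+ 2)); rewrite -[(2 ^ 2)%N]/4%N -[(2 * 2)%N]/4%N; ring.
- by rewrite t_sqr //; apply: (eq_mod2 (- t y - 1)); ring.
Qed.

(** The map t |-> tau read in the coordinate y, so that it becomes a self-map of [T1]. *)
Definition sigma (y : K) : K := tau y ^+ 2 + tau y + 1.

Lemma phi_Fq y : y \in T1 -> phi y \in Fq.
Proof. by move=> hy; rewrite FqM ?t_Fq // FqV //; case/T1P: hy. Qed.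

Lemma tau_Fq y : y \in T1 -> tau y \in Fq.
Proof. by move=> hy; rewrite /tau FqD ?FqX ?phi_Fq // FqD ?t_Fq ?phi_Fq. Qed.

Lemma Tr_tau y : y \in T1 -> Tr (tau y) = 0.
Proof.
move=> hy; rewrite !TrD Tr_t // add0r -[phi y ^+ 4]/(phi y ^+ (2 ^ 2)).
by rewrite Tr_frob ?phi_Fq // addxx.
Qed.

Lemma t_sigma y : y \in T1 -> t (sigma y) = tau y.
Proof. by move=> hy; rewrite /t addxK H_K ?tau_Fq ?Tr_tau. Qed.

Lemma sigma_T1 y : y \in T1 -> sigma y \in T1.
Proof.
move=> hy; have hF := tau_Fq _ hy; apply/T1P; split; first by rewrite /sigma FqD ?Fq1 // FqD ?FqX.
by rewrite (TrD (_ + _)) TrD Tr_sqr // addxx add0r TrS1.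
Qed.

(** F_4 meets F_q in F_2 for odd m: d^2 + d is idempotent, and it is not 1 because its trace is 0
    whereas Tr 1 = 1. *)
Lemma Fq_exp4_fix (d : K) : d \in Fq -> d ^+ 4 = d -> d = 0 \/ d = 1.
Proof.
move=> dF d4; have e2 : (d ^+ 2 + d) ^+ 2 = d ^+ 2 + d.
  by rewrite sqrD -exprM d4 addrC.
case: (idem01 _ e2) => e; first by apply: idem01; apply: addx_eq0.
have : Tr (d ^+ 2 + d) = 0 by rewrite TrD Tr_sqr // addxx.
by rewrite e TrS1 => /eqP; rewrite oner_eq0.
Qed.

(* z2 may have to be replaced by its conjugate z2 + 1, which lies over the same t. *)
Lemma sigma_inj : injective evalF -> {in T1 &, injective sigma}.
Proof.
move=> F_inj y1 y2 hy1 hy2 /(congr1 t); rewrite !t_sigma // => htau.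
have [z1 [z1q z1t y1t]] := evalF_fiber _ hy1.
have [z2 [z2q z2t y2t]] := evalF_fiber _ hy2.
have y10 := T1_neq0 _ hy1; have y20 := T1_neq0 _ hy2.
have [y1F _] := T1P _ hy1; have [y2F _] := T1P _ hy2.
(* This is f(z1) + f(z2) for f(z) = z + phi. It lies in F_q, and d^4 + d = tau y1 + tau y2 = 0, so d
   is 0 or 1 and z2 + d has the same value of f as z1. *)
pose d : K := z1 + phi y1 + (z2 + phi y2).
have dF : d \in Fq.
  apply/FqP; rewrite !frobD z1q z2q (FqP _ (phi_Fq _ hy1)) (FqP _ (phi_Fq _ hy2)).
  by apply: (eq_mod2 1); rewrite /d; ring.
have d4 : d ^+ 4 = d.
  apply: addx_eq0; rewrite !(frobD _ _ 2) -[(2 ^ 2)%N]/4%N.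
  rewrite -[RHS](addxx (tau y1)) {2}htau /tau -z1t -z2t /d; ring.
have {d4} d01 := Fq_exp4_fix _ dF d4.
pose z := z2 + d.
have zq : z ^+ q = z + 1 by rewrite frobD z2q (FqP _ dF) addrAC.
have zt : z ^+ 4 + z = t y2.
  rewrite (frobD _ _ 2) -[(2 ^ 2)%N]/4%N -z2t /z.
  by case: d01 => ->; [ring | apply: (eq_mod2 1); ring].
have Fz1 : evalF z1 = y1 * (z1 + phi y1).
  by rewrite evalF_conj // z1t -y1t /phi; field.
have Fz : evalF z = y2 * (z1 + phi y1).
  rewrite evalF_conj // zt -y2t; transitivity (y2 * (z + phi y2)); first by rewrite /phi; field.
  congr (_ * _); rewrite /z /d; apply: (eq_mod2 (z2 + phi y2)); ring.
(* F(z1) and F(z) now differ only by the factor y1 / y2, which the homogeneity of F under F_q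
   absorbs. *)
have [b bF b9] := ninth_root (y1 / y2) (FqM _ _ y1F (FqV _ y2F)) (mulf_neq0 y10 (invr_neq0 y20)).
have b0 : b != 0 by apply/eqP=> b0; move/eqP: b9; rewrite b0 expr0n eq_sym mulf_eq0 invr_eq0 (negPf y10) (negPf y20).
have zb : z1 = b * z.
  by apply: F_inj; rewrite evalF_homog // b9 Fz Fz1; field.
(* Raising z1 = b z to the power q and comparing with z1 = b z itself leaves b = 1. *)
have zb1 : z1 + 1 = b * z + b by rewrite -z1q zb exprMn (FqP _ bF) zq mulrDr mulr1.
have b1 : b = 1 by move: zb1; rewrite zb => /addrI <-.
by rewrite y1t y2t -z1t -zt zb b1 mul1r.
Qed.

Lemma evalF_not_inj_odd : ~ injective evalF.
Proof.
(* An injective self-map of the finite set [T1] is onto, so reindexing along [sigma] equates the two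
   fifth power sums, against [sum_tau5]. *)
move=> F_inj; have sT : [set sigma y | y in T1] = [set y in T1].
  apply/eqP; rewrite eqEcard card_in_imset ?cardsE ?leqnn ?andbT; last exact: sigma_inj.
  by apply/subsetP=> _ /imsetP[y hy ->]; rewrite inE sigma_T1.
have := sum_tau5; rewrite (eq_bigr (fun y => t (sigma y) ^+ 5)) => [|y hy]; last by rewrite t_sigma.
rewrite -(big_imset (fun y => t y ^+ 5)) /=; last exact: sigma_inj.
rewrite sT big_set /= -{1}[LHS]addr0 => /addrI/eqP.
by rewrite eq_sym oner_eq0.
Qed.

End OddDegree.
End BinaryField.

(** * Conclusion by the parity of m *)

Theorem theorem5p3 (m q : nat) (K : finFieldType)
  (hm : (3 < m)%N) (hq : q = (2 ^ m)%N) (hK : #|K| = (q ^ 2)%N) :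
  let F : {poly K} :=
    'X^9 * ('X^(7 * (q - 1))%N + 'X^(3 * (q - 1))%N + 1) in
  ~ permutation_poly F.
Proof.
move=> F /bij_inj F_inj; rewrite {q}hq in F F_inj hK *.
have {}F_inj : injective (evalF K m).
  have e x : evalF K m x = F.[x] by rewrite /F !hornerE.
  by move=> x y; rewrite !e => /F_inj.
have m0 : (0 < m)%N by exact: ltn_trans hm.
have [m_odd|m_even] := boolP (odd m).
  have def_n : (m.+1)./2.*2 = m.+1 by rewrite -[RHS]odd_double_half /= m_odd.
  have m4 : (4 < m)%N by rewrite ltn_neqAle hm andbT; apply: contraTneq m_odd => <-.
  exact: (evalF_not_inj_odd K m m0 hK _ m4 def_n F_inj).
apply: (evalF_not_inj_even K m m0 hK _ F_inj).
have -> : m = (2 * m./2)%N by rewrite mul2n -[LHS]odd_double_half (negPf m_even).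
by rewrite -eqn_mod_dvd ?expn_gt0 // expnM -modnXm exp1n.
Qed.
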